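(* Let $(X,d,\mu)$ be an Ahlfors $\gamma$-regular space ($\gamma>0$), let $\mathcal{D}$ be a dyadic family on $X$, and let $\sigma>0$. Then for every $j\in\mathbb{Z}$ the space $H^\sigma_{d,\mu}\cap \mathrm{Ker}\,P_j$ is a space of coercivity for $\mathscr{E}^{d,\mu}_\sigma$. In other words, for every $j\in\mathbb{Z}$ there is a constant $C>0$ depending on $j$ such that for every $u\in H^\sigma_{d,\mu}$ with $P_ju=0$, $$\mathscr{E}^{d,\mu}_\sigma(u)\ge C\,\|u\|^2_{L^2(X,\mu)}.$$
   Context: All functions are real valued. A metric space $(X,d)$ with a Borel measure $\mu$ is Ahlfors $\gamma$-regular if there are constants $c_1,c_2>0$ with $c_1r^\gamma\le\mu(B(x,r))\le c_2r^\gamma$ for all $x\in X$ and $r>0$, where $B(x,r)=\{y\in X:d(x,y)<r\}$. Dyadic family: $\mathcal{D}=\bigcup_{j\in\mathbb{Z}}\mathcal{D}_j$ is a family of subsets of $X$ (called cubes) such that: there are $0<\nu<1$ and positive constants $a_1,a_2,a_3$ such that every $Q\in\mathcal{D}_j$ satisfies $a_1\nu^j\le \mathrm{diam}\,Q\le a_2\nu^j$ and there are $d$-balls $B_1\subseteq Q\subseteq B_2$ whose radii satisfy $r(B_1)\ge a_3\, r(B_2)$; each cube is a Borel set; each $\mathcal{D}_j$ is a partition of $X$; for each $Q\in\mathcal{D}_{j+1}$ there is exactly one $\widetilde Q\in\mathcal{D}_j$ with $Q\subseteq\widetilde Q$; there is a constant $M$ with $1\le\#\vartheta(Q)\le M$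 for every $Q\in\mathcal{D}_j$, where $\vartheta(Q)=\{Q'\in\mathcal{D}_{j+1}:Q'\subseteq Q\}$; any two cubes are disjoint or one contains the other; for every $Q\in\mathcal{D}$ the union of all cubes of $\mathcal{D}$ containing $Q$ is $X$. $P_j$ is the orthogonal projection of $L^2(X,\mu)$ onto $V_j=\{f\in L^2(X,\mu): f\text{ is constant on each }Q\in\mathcal{D}_j\}$. Energy: for $\sigma>0$, $\mathscr{E}^{d,\mu}_\sigma(u)=\iint_{X\times X}\frac{|u(x)-u(y)|^2}{\mu(B(x,d(x,y)))^{1+2\sigma}}\,d\mu(x)d\mu(y)$, and $H^\sigma_{d,\mu}=\{u\in L^2(X,\mu):\mathscr{E}^{d,\mu}_\sigma(u)<\infty\}$ with norm $\|u\|_{L^2}+\sqrt{\mathscr{E}^{d,\mu}_\sigma(u)}$. A closed linear subspace of $H^\sigma_{d,\mu}$ is a space of coercivity for $\mathscr{E}^{d,\mu}_\sigma$ if there is a constant $c>0$, depending on the subspace, with $\mathscr{E}^{d,\mu}_\sigma(u)\ge c\|u\|^2_{L^2}$ for every $u$ in it. *)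

(* Defs.v *)
From HB Require Import structures.
From mathcomp Require Import all_boot all_order all_algebra.
From mathcomp Require Import all_classical all_reals all_analysis.

Set Implicit Arguments.
Unset Strict Implicit.
Unset Printing Implicit Defensive.

Import Order.TTheory GRing.Theory Num.Theory.
Import numFieldNormedType.Exports.

Local Open Scope classical_set_scope.
Local Open Scope ring_scope.

(* The library's measurable types are pointed, whereas metricType is not. *)
#[short(type="pointedMetricType")]
HB.structure Definition PointedMetric (R : numDomainType) :=
  {X of Metric R X & isPointed X}.

Definition borel {R : realType} (X : pointedMetricType R) :=
  g_sigma_algebraType (@open X).

Section MetricMeasure.
Context {R : realType} {X : pointedMetricType R}.
Variable mu : {measure set (borel X) -> \bar R}.

Definition ahlfors_regular (gamma : R) : Prop :=
  exists c1 c2 : R, [/\ 0 < c1, 0 < c2 &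
    forall (x : X) (r : R), 0 < r ->
      ((c1 * r `^ gamma)%:E <= mu (ball x r))%E /\
      (mu (ball x r) <= (c2 * r `^ gamma)%:E)%E].

Definition diameter (Q : set X) : \bar R :=
  ereal_sup [set (mdist x y)%:E | x in Q & y in Q].

Definition cubes (D : int -> set (set X)) : set (set X) := \bigcup_j D j.

Definition children (D : int -> set (set X)) (j : int) (Q : set X) :
    set (set X) :=
  [set Q' | D (j + 1) Q' /\ Q' `<=` Q].

Record dyadic_family (D : int -> set (set X)) : Prop := DyadicFamily {
  dyadic_size : exists nu a1 a2 a3 : R,
    [/\ 0 < nu < 1, 0 < a1, 0 < a2, 0 < a3 &
      forall (j : int) (Q : set X), D j Q ->
        [/\ ((a1 * nu ^ j)%:E <= diameter Q)%E,
            (diameter Q <= (a2 * nu ^ j)%:E)%E &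
            exists (x1 x2 : X) (r1 r2 : R),
              [/\ 0 < r1, 0 < r2, ball x1 r1 `<=` Q, Q `<=` ball x2 r2 &
                  a3 * r2 <= r1]]];
  dyadic_borel : forall Q, cubes D Q -> measurable (Q : set (borel X));
  dyadic_partition : forall j, partition (D j) id [set: X];
  dyadic_parent : forall (j : int) Q, D (j + 1) Q ->
    exists! Q' : set X, D j Q' /\ Q `<=` Q';
  dyadic_children : exists M : nat, forall j Q, D j Q ->
    exists2 n : nat, (1 <= n <= M)%N & (children D j Q #= `I_n)%card;
  dyadic_nested : forall Q1 Q2, cubes D Q1 -> cubes D Q2 ->
    [\/ Q1 `&` Q2 = set0, Q1 `<=` Q2 | Q2 `<=` Q1];
  dyadic_quadrant : forall Q, cubes D Q ->
    \bigcup_(Q' in [set Q' | cubes D Q' /\ Q `<=` Q']) Q' = [set: X]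
}.

(* Elements of L^2 are represented by square-integrable functions. All notions
   below depend only on almost everywhere classes, except that stepL2 consists
   of the representatives that are genuinely constant on each cube. *)
Definition L2 : set (borel X -> R) := [set u | u \in Lfun mu 2%:E].

Definition L2norm (u : borel X -> R) : \bar R := 'N[mu]_(2%:E)[EFin \o u]%E.

Definition L2inner (u v : borel X -> R) : \bar R :=
  (\int[mu]_x (u x * v x)%:E)%E.

Definition stepL2 (D : int -> set (set X)) (j : int) : set (borel X -> R) :=
  [set f | L2 f /\
    forall Q, D j Q -> forall x y, Q x -> Q y -> f x = f y].

Definition orthogonal_projection (V : set (borel X -> R))
    (u v : borel X -> R) : Prop :=
  V v /\ forall w, V w -> L2inner (fun x => u x - v x) w = 0%E.

Definition kerP (D : int -> set (set X)) (j : int) : set (borel X -> R) :=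
  [set u | L2 u /\
    exists2 v, orthogonal_projection (stepL2 D j) u v & {ae mu, forall x, v x = 0}].

(* On the diagonal the integrand is 0 / 0, which evaluates to 0 * +oo = 0. *)
Definition energy (sigma : R) (u : borel X -> R) : \bar R :=
  (\int[mu]_y \int[mu]_x
     ((`|u x - u y| ^+ 2)%:E
        / (mu (ball (x : X) (mdist (x : X) y)) `^ (1 + 2 * sigma))))%E.

Definition Hspace (sigma : R) : set (borel X -> R) :=
  [set u | L2 u /\ (energy sigma u < +oo)%E].

Definition Hnorm (sigma : R) (u : borel X -> R) : \bar R :=
  (L2norm u + sqrte (energy sigma u))%E.

Definition linear_subspace (S : set (borel X -> R)) : Prop :=
  S (cst 0) /\
  forall (a : R) u v, S u -> S v -> S (fun x => a * u x + v x).

Definition Hclosed (sigma : R) (S : set (borel X -> R)) : Prop :=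
  forall u, Hspace sigma u ->
    (forall e : R, 0 < e ->
       exists2 v, S v & (Hnorm sigma (fun x => u x - v x)%R < e%:E)%E) ->
    S u.

Definition space_of_coercivity (sigma : R) (S : set (borel X -> R)) : Prop :=
  [/\ S `<=` Hspace sigma, linear_subspace S, Hclosed sigma S &
      exists2 c : R, 0 < c &
        forall u, S u -> (c%:E * L2norm u ^+ 2 <= energy sigma u)%E].

End MetricMeasure.

(* Main.v *)
Require Import Defs.
From HB Require Import structures.
From mathcomp Require Import all_boot all_order all_algebra.
From mathcomp Require Import all_classical all_reals all_analysis.
From mathcomp Require Import measurable_realfun ring.
Import Order.TTheory GRing.Theory Num.Theory.
Import numFieldNormedType.Exports.
Local Open Scope classical_set_scope.
Local Open Scope ring_scope.

Set Implicit Arguments.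
Unset Strict Implicit.
Unset Printing Implicit Defensive.

(** Let [y] lie in the cube [Q] of [D j]. On [Q] the energy kernel is bounded
    below by a constant, because Ahlfors regularity controls the measure of
    balls of radius at most the diameter of [Q]. The kernel of [P_j] consists of
    the [u] with mean zero on every such [Q], so that
    [\int_Q (u x - u y)^2 dx >= mu Q * (u y)^2]; as [mu Q] is bounded below
    uniformly in [Q], integrating over [y] gives the coercivity estimate.

    That [H^sigma] is a vector space rests on the additivity of the double
    integral, hence on the joint measurability of the kernel. The cubes of each
    level are countably many, so [X] is separable, the distance is measurable
    for the product of the Borel algebras, and so is
    [(x, y) |-> mu (ball x (mdist x y))]. *)

(** * Finiteness of disjoint families of large sets *)

(** An infinite family contains an injective sequence; its first [n] members are disjoint in [A], so
    [n * c <= mu A] for every [n]. *)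
Lemma finite_disjoint_measure_ge (d : measure_display) (T : measurableType d)
    (R : realType) (mu : {measure set T -> \bar R})
    (F : set (set T)) (A : set T) (c : R) :
  measurable A -> (mu A < +oo)%E -> 0 < c -> trivIset F id ->
  (forall Q, F Q -> [/\ measurable Q, Q `<=` A & (c%:E <= mu Q)%E]) ->
  finite_set F.
Proof.
move=> mA Aoo c0 tF FP; apply: contrapT => /infiniteP/pcard_leP[f].
have fF k : F (f k) by exact: funS.
have key n : ((c *+ n)%:E <= mu A)%E.
  have tf : trivIset setT (fun k : nat => f k).
    move=> i k _ _ ne; apply: (@inj _ _ _ f); rewrite ?inE//.
    exact: (tF _ _ (fF i) (fF k) ne).
  apply: (@le_trans _ _ (mu (\big[setU/set0]_(k < n) f k))); last first.
    apply: le_measure; rewrite ?inE//.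
      by apply: bigsetU_measurable => k _; have [] := FP _ (fF k).
    by rewrite -bigcup_mkord => x [k _]; have [_ + _] := FP _ (fF k); exact.
  rewrite measure_bigsetU//; last by move=> k; have [] := FP _ (fF k).
  rewrite (@le_trans _ _ (\sum_(k < n) c%:E)%E)//.
    by rewrite sumEFin big_const iter_addr addr0 card_ord.
  by apply: lee_sum => k _; have [] := FP _ (fF k).
have Afin : mu A \is a fin_num by rewrite ge0_fin_numE.
have := key (Num.truncn (fine (mu A) / c)).+1.
rewrite -(fineK Afin) lee_fin -mulr_natl leNgt => /negP; apply.
by rewrite -ltr_pdivrMr// truncnS_gt.
Qed.

(** * Balls and dyadic cubes under Ahlfors regularity *)

Section MetricBorel.
Context {R : realType} {X : pointedMetricType R}.

Lemma borel_measurable_ball (x : X) (r : R) :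
  measurable (ball x r : set (borel X)).
Proof.
apply: sub_sigma_algebra; rewrite /= openE => y.
rewrite ballEmdist/= => xy; apply/nbhs_ballP.
exists (r - mdist x y); first by rewrite /= subr_gt0.
move=> z; rewrite !ballEmdist/= => yz.
by rewrite (le_lt_trans (metric_triangle x y z))// -ltrBrDl.
Qed.

Variable mu : {measure set (borel X) -> \bar R}.

Section Regular.
Variable gamma : R.
Hypothesis regX : ahlfors_regular mu gamma.

Lemma regular_ball_lty (x : X) (r : R) : (mu (ball x r) < +oo)%E.
Proof.
have [c1 [c2 [_ _ /(_ x)h]]] := regX.
have [r0|r0] := ltP 0 r.
  by have [_ /le_lt_trans->//] := h _ r0; rewrite ltry.
suff -> : ball x r = set0 by rewrite measure0.
rewrite ballEmdist -subset0 => y /=.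
by rewrite ltNge (le_trans r0)// mdist_ge0.
Qed.

Lemma bigcup_ball (x : X) : \bigcup_n ball x n.+1%:R = [set: X].
Proof.
rewrite -subTset => y _; exists (Num.truncn (mdist x y)) => //.
by rewrite ballEmdist/= truncnS_gt.
Qed.

Lemma regular_sigma_finite : sigma_finite setT mu.
Proof.
exists (fun n => ball (point : X) n.+1%:R); first by rewrite bigcup_ball.
by move=> n; split; [exact: borel_measurable_ball|exact: regular_ball_lty].
Qed.

Variable D : int -> set (set X).
Hypothesis dyadicD : dyadic_family D.

Lemma dyadic_mdist : exists nu a : R, [/\ 0 < nu < 1, 0 < a &
  forall j Q x y, D j Q -> Q x -> Q y -> mdist x y <= a * nu ^ j].
Proof.
have [nu [a1 [a2 [a3 [nu01 _ a20 _ h]]]]] := dyadic_size dyadicD.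
exists nu, a2; split=> // j Q x y DQ Qx Qy.
have [_ + _] := h _ _ DQ; rewrite -lee_fin; apply: le_trans.
by apply: ereal_sup_ubound => /=; exists x => //; exists y.
Qed.

(** The outer ball forces [a1 * nu ^ j <= diameter Q <= 2 * r2], hence
    [r1 >= a3 * r2 >= a3 * (a1 * nu ^ j / 2)], a radius common to all cubes of the level. *)
Lemma dyadic_inner_ball j : exists2 r : R, 0 < r &
  forall Q, D j Q -> exists x, ball x r `<=` Q.
Proof.
have [nu [a1 [a2 [a3 [/andP[nu0 _] a10 a20 a30 h]]]]] := dyadic_size dyadicD.
exists (a3 * (a1 * nu ^ j / 2)).
  by rewrite !mulr_gt0// exprz_gt0.
move=> Q DQ; have [lo _ [x1 [x2 [r1 [r2 [r10 r20 s1 s2 r21]]]]]] := h _ _ DQ.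
exists x1; apply: subset_trans s1; apply: le_ball.
apply: le_trans r21; rewrite ler_pM2l// ler_pdivrMr// -lee_fin.
apply: le_trans lo _; apply: ge_ereal_sup => _ [x Qx [y Qy <-]].
rewrite lee_fin (le_trans (metric_triangle x x2 y))// metric_sym.
have := s2 _ Qx; have := s2 _ Qy; rewrite ballEmdist/= => /ltW h1 /ltW h2.
by rewrite mulr_natr mulr2n lerD.
Qed.

Lemma dyadic_cover j (x : X) : exists2 Q, D j Q & Q x.
Proof.
have [+ _ _] := dyadic_partition dyadicD j.
by rewrite /cover -subTset => /(_ x I)[Q DQ Qx]; exists Q.
Qed.

Lemma dyadic_measurable j Q : D j Q -> measurable (Q : set (borel X)).
Proof. by move=> DQ; apply: (dyadic_borel dyadicD); exists j. Qed.

Lemma dyadic_measure_lty j Q : D j Q -> (mu Q < +oo)%E.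
Proof.
move=> DQ; have [nu [a [_ _ h]]] := dyadic_mdist.
have [->|/set0P[x Qx]] := eqVneq Q set0; first by rewrite measure0.
(* The added [1] turns the non-strict diameter bound into the strict inequality of an open ball. *)
apply: le_lt_trans (regular_ball_lty x (a * nu ^ j + 1)).
apply: le_measure; rewrite ?inE.
- exact: dyadic_measurable DQ.
- exact: borel_measurable_ball.
move=> y Qy; rewrite ballEmdist/=.
by rewrite (le_lt_trans (h _ _ _ _ DQ Qx Qy))// ltrDl.
Qed.

Lemma dyadic_measure_ge j : exists2 m : R, 0 < m &
  forall Q, D j Q -> (m%:E <= mu Q)%E.
Proof.
have [r r0 h] := dyadic_inner_ball j.
have [c1 [c2 [c10 _ reg]]] := regX.
exists (c1 * r `^ gamma); first by rewrite mulr_gt0// powR_gt0.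
move=> Q DQ; have [x xQ] := h _ DQ.
have [/le_trans + _] := reg x _ r0; apply.
apply: le_measure => //; rewrite ?inE; first exact: borel_measurable_ball.
exact: dyadic_measurable DQ.
Qed.

(** The cubes of level [j] meeting a fixed ball are disjoint, lie in one larger ball of finite
    measure and have measure at least [m], so they are finitely many. Countably many balls exhaust
    [X]. *)
Lemma dyadic_countable j : countable (D j).
Proof.
pose F n := [set Q | D j Q /\ Q `&` ball (point : X) n.+1%:R !=set0].
have [_ tD neD] := dyadic_partition dyadicD j.
have -> : D j = \bigcup_n F n.
  apply/seteqP; split => [Q DQ|Q [n _ []]//].
  have [x Qx] := neD _ DQ.
  have : [set: X] x by [].
  rewrite -(bigcup_ball point) => -[n _ nx].
  by exists n => //; split=> //; exists x.
apply: bigcup_countable => // n _; apply: finite_set_countable.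
have [nu [a [_ _ h]]] := dyadic_mdist.
have [m m0 hm] := dyadic_measure_ge j.
apply: (@finite_disjoint_measure_ge _ _ _ mu _
  (ball (point : X) (n.+1%:R + a * nu ^ j)) m) => //.
- exact: borel_measurable_ball.
- exact: regular_ball_lty.
- by move=> P Q [DP _] [DQ _]; exact: tD.
move=> Q [DQ [x [Qx]]]; rewrite ballEmdist/= => nx; split.
- exact: dyadic_measurable DQ.
- move=> y Qy; rewrite ballEmdist/= (le_lt_trans (metric_triangle _ x y))//.
  by rewrite ltr_leD// (h _ _ _ _ DQ).
- exact: hm.
Qed.

End Regular.
End MetricBorel.

(** Rewriting with this equality makes the section and Tonelli theorems, stated for bundled
    sigma-finite measures, applicable to [mu]. *)
Lemma sigma_finite_measureP (d : measure_display) (T : measurableType d)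
    (R : realType) (mu : {measure set T -> \bar R}) : sigma_finite setT mu ->
  exists mu' : {sigma_finite_measure set T -> \bar R},
    mu = mu' :> {measure set T -> \bar R}.
Proof.
case: mu => m cm mu_sfin.
have @mu' : {sigma_finite_measure set T -> \bar R} := HB.pack m cm
  (Measure_isSigmaFinite.Build _ _ _ (Measure.Pack cm) mu_sfin).
by exists mu'; congr Measure.Pack; case: cm @mu' mu_sfin.
Qed.

(** * Joint measurability of the distance and of the energy kernel *)

Section Kernel.
Context {R : realType} {X : pointedMetricType R}.
Variable mu : {measure set (borel X) -> \bar R}.
Variable gamma : R.
Hypothesis regX : ahlfors_regular mu gamma.
Variable D : int -> set (set X).
Hypothesis dyadicD : dyadic_family D.

(* A level of cubes of small diameter provides a countable net, which is what
   makes the distance measurable for the product of the Borel algebras. *)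
Lemma measurable_mdist :
  measurable_fun setT (fun z : borel X * borel X => mdist (z.1 : X) z.2).
Proof.
have [nu [a [/andP[nu0 nu1] a0 h]]] := dyadic_mdist dyadicD.
apply: (measurability _ (RGenInftyO.measurableE R)) => //.
move=> _ [_ [r ->] <-]; rewrite setTI.
(* The set [mdist < r] is written as a countable union of rectangles [F n Q]. The radius is
   shortened by [a * nu ^+ n], the diameter bound of [Q], so that the triangle inequality through
   the center keeps each rectangle inside the set. *)
pose center (Q : set X) : X := xget point Q.
pose F (n : nat) (Q : set X) : set (borel X * borel X) :=
  Q `*` ball (center Q) (r - a * nu ^+ n).
have centerP (n : nat) Q : D n Q -> Q (center Q).
  move=> DQ; have [_ _ /(_ _ DQ) [x Qx]] := dyadic_partition dyadicD n.
  by apply: (@xgetPex _ point Q); exists x.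
rewrite [X in measurable X](_ : _ = \bigcup_n \bigcup_(Q in D n%:Z) F n Q).
  apply: bigcupT_measurable => n; rewrite bigcup_set_type.
  apply: countable_bigcupT_measurable.
    rewrite (eq_countable (card_setT _)).
    exact: (dyadic_countable regX dyadicD).
  move=> [Q DQ]; rewrite /F/=; apply: measurableX; last first.
    exact: borel_measurable_ball.
  by apply: (dyadic_measurable dyadicD); exact: set_mem DQ.
apply/seteqP; split => [[x y]|[x y]]; rewrite /= in_itv/=.
  move=> xyr.
  (* The diameter bound is spent twice: in the shortened radius and in moving from [x] to the center
     of its cube. *)
  have [n Hn] : exists n : nat, a * nu ^+ n + a * nu ^+ n < r - mdist (x : X) y.
    have e0 : 0 < (r - mdist (x : X) y) / a / 2 by rewrite !divr_gt0// subr_gt0.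
    have nuN : `|nu| < 1 by rewrite gtr0_norm.
    have /cvgr0Pnorm_lt/(_ _ e0)[n _ /(_ n (leqnn n))/=] := cvg_expr nuN.
    rewrite gtr0_norm ?exprn_gt0// => H; exists n.
    by rewrite -mulrDr -mulr2n -mulr_natr mulrC -ltr_pdivlMr// -ltr_pdivlMr.
  have [Q DQ Qx] := dyadic_cover dyadicD n%:Z x.
  exists n => //; exists Q => //; split => //=.
  rewrite ballEmdist/= (le_lt_trans (metric_triangle _ (x : X) _))//.
  have := h _ _ _ _ DQ (centerP _ _ DQ) Qx; rewrite -exprnP => H.
  by rewrite ltrBrDr -addrA (le_lt_trans (lerD H (lexx _)))// addrCA -ltrBrDl.
move=> [n _ [Q DQ [/= Qx]]]; rewrite ballEmdist/= => cy.
have := h _ _ _ _ DQ Qx (centerP _ _ DQ); rewrite -exprnP => H.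
rewrite (le_lt_trans (metric_triangle _ (center Q) _))//.
by rewrite (le_lt_trans (lerD H (lexx _)))// addrC -ltrBrDr.
Qed.

Variable sigma : R.

(** Real form of the reciprocal in the energy: [fine] loses nothing since balls have finite measure,
    and the diagonal value is harmless since it multiplies [u x - u x]. *)
Definition energy_kernel (z : borel X * borel X) : R :=
  fine (mu (ball (z.1 : X) (mdist (z.1 : X) z.2))) `^ (- (1 + 2 * sigma)).

Lemma measurable_energy_kernel : measurable_fun setT energy_kernel.
Proof.
have mB : measurable_fun setT ((fun z =>
    mu (ball (z.1 : X) (mdist (z.1 : X) z.2))) : borel X * borel X -> \bar R).
  have [mu' ->] := sigma_finite_measureP (regular_sigma_finite regX).
  (* The section of [A] at [z] is the ball in question, and the measure of the sections of a
     measurable set is a measurable function. *)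
  pose A := [set w : (borel X * borel X) * borel X |
    mdist (w.1.1 : X) w.2 < mdist (w.1.1 : X) w.1.2].
  have mA : measurable A.
    rewrite -[A]setTI.
    have mlt : measurable_fun setT (fun w : (borel X * borel X) * borel X =>
        mdist (w.1.1 : X) w.2 < mdist (w.1.1 : X) w.1.2).
      have m11 : measurable_fun setT (fun w : (borel X * borel X) * borel X =>
          (w.1.1, w.2)).
        apply: measurable_fun_pair => //.
        exact: (measurableT_comp measurable_fst measurable_fst).
      apply: measurable_fun_ltr.
        exact: (measurableT_comp measurable_mdist m11).
      exact: (measurableT_comp measurable_mdist measurable_fst).
    exact: (mlt measurableT [set true]).
  rewrite [X in measurable_fun _ X](_ : _ = mu' \o xsection A).
    exact: measurable_fun_xsection.
  apply/funext => z /=; congr (mu' _); rewrite ballEmdist.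
  by apply/seteqP; split => y; rewrite /xsection/= inE.
apply: (measurableT_comp (measurable_powR _)).
exact: measurableT_comp mB.
Qed.

End Kernel.

(** * Square-integrable functions and the kernel of [P_j] *)

Section L2Theory.
Context {R : realType} {X : pointedMetricType R}.
Variable mu : {measure set (borel X) -> \bar R}.
Implicit Types u v w : borel X -> R.

Lemma L2_measurable u : L2 mu u -> measurable_fun setT u.
Proof. by rewrite /L2/= inE => /andP[]; rewrite inE. Qed.

Lemma L2normX2 u : (L2norm mu u ^+ 2 = \int[mu]_x (u x ^+ 2)%:E)%E.
Proof.
have -> : (\int[mu]_x (u x ^+ 2)%:E = L2norm mu u `^ 2)%E.
  rewrite powR_Lnorm//; apply: eq_integral => x _ /=.
  by rewrite powR_mulrn// real_normK// num_real.
have : (0 <= L2norm mu u)%E by exact: Lnorm_ge0.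
case: (L2norm mu u) => [r|_|//]; last by rewrite poweRyr.
by rewrite lee_fin => r0; rewrite poweR_EFin powR_mulrn// expr2 EFinM.
Qed.

Lemma L2P u : measurable_fun setT u -> (\int[mu]_x (u x ^+ 2)%:E < +oo)%E ->
  L2 mu u.
Proof.
move=> mfu uoo; rewrite /L2/= inE; apply/andP; split; rewrite inE//=.
rewrite /finite_norm unlock poweR_lty//.
under eq_integral do rewrite /= powR_mulrn// real_normK ?num_real//.
exact: uoo.
Qed.

Lemma L2_linear (a : R) u v : L2 mu u -> L2 mu v ->
  L2 mu (fun x => a * u x + v x).
Proof.
have [_ h] := @Lfun_submod_closed _ _ _ mu 2%:E (lee1n 2).
by move=> Lu Lv; exact: (h a u v).
Qed.

Lemma L2_cst0 : L2 mu (cst 0).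
Proof. by have [] := @Lfun_submod_closed _ _ _ mu 2%:E (lee1n 2). Qed.

Lemma L2_sub u v : L2 mu u -> L2 mu v -> L2 mu (fun x => u x - v x).
Proof.
move=> Lu Lv; rewrite (_ : (fun _ => _) = fun x => -1 * v x + u x).
  exact: L2_linear.
by apply/funext => x; rewrite mulN1r addrC.
Qed.

Lemma L2_indic (A : set (borel X)) : measurable A -> (mu A < +oo)%E ->
  L2 mu \1_A.
Proof.
move=> mA Aoo; apply: L2P; first exact: measurable_indic.
rewrite (eq_integral (fun x => (\1_A x)%:E)).
  by rewrite integral_indic// setIT.
by move=> x _; rewrite indicE; case: (_ \in _); rewrite ?expr1n ?expr0n.
Qed.

Lemma L2_mul_integrable u v : L2 mu u -> L2 mu v ->
  mu.-integrable setT (fun x => (u x * v x)%:E).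
Proof. by move=> Lu Lv; have /Lfun1_integrable := Lfun2_mul_Lfun1 Lu Lv. Qed.

Lemma L2inner_linear (a : R) u v w : L2 mu u -> L2 mu v -> L2 mu w ->
  (L2inner mu (fun x => (a * u x + v x)%R) w =
   a%:E * L2inner mu u w + L2inner mu v w)%E.
Proof.
move=> Lu Lv Lw; rewrite /L2inner.
under eq_integral do rewrite mulrDl -mulrA EFinD EFinM.
have Iu := L2_mul_integrable Lu Lw.
rewrite integralD//; [|exact: integrableZl|exact: L2_mul_integrable].
by rewrite integralZl.
Qed.

(** Cauchy-Schwarz, from Hoelder with both exponents [2]. *)
Lemma L2inner_le u v : L2 mu u -> L2 mu v ->
  (`|L2inner mu u v| <= L2norm mu u * L2norm mu v)%E.
Proof.
move=> Lu Lv; have mfu := L2_measurable Lu; have mv := L2_measurable Lv.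
apply: (@le_trans _ _ (\int[mu]_x `|(u x * v x)%:E|)%E).
  apply: le_abse_integral => //; apply/measurable_EFinP.
  exact: measurable_funM.
have := @hoelder _ _ _ mu u v 2 2 mfu mv; rewrite Lnorm1; apply => //.
by rewrite [RHS]splitr !div1r.
Qed.

(** Subtracting a [v] that vanishes almost everywhere changes no inner product; conversely, if [u]
    is orthogonal to [V_j], then [cst 0] serves as its projection. *)
Lemma kerPP (D : int -> set (set X)) j u : kerP mu D j u <->
  L2 mu u /\ forall w, stepL2 mu D j w -> L2inner mu u w = 0%E.
Proof.
split=> [[Lu [v [[Lv _] uv] v0]]|[Lu u0]]; split=> //.
  move=> w sw; rewrite -(uv _ sw); have [Lw _] := sw.
  apply: ae_eq_integral => //.
  - apply/measurable_EFinP; apply: measurable_funM; exact: L2_measurable.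
  - apply/measurable_EFinP; apply: measurable_funM; last exact: L2_measurable.
    exact: L2_measurable (L2_sub Lu Lv).
  - by apply: filterS v0 => x /= -> _; rewrite subr0.
exists (cst 0); last exact: aeW.
split; first by split => //; exact: L2_cst0.
move=> w sw; rewrite -[RHS](u0 _ sw); apply: eq_integral => x _.
by rewrite subr0.
Qed.

Lemma kerP_linear_subspace (D : int -> set (set X)) j :
  linear_subspace (kerP mu D j).
Proof.
split=> [|a u v /kerPP[Lu u0] /kerPP[Lv v0]]; apply/kerPP; split.
- exact: L2_cst0.
- by move=> w _; apply: integral0_eq => x _; rewrite mul0r.
- exact: L2_linear.
- move=> w sw; have [Lw _] := sw.
  by rewrite L2inner_linear// u0// v0// mule0 adde0.
Qed.

(** For [w] in [V_j] the inner product of [u] with [w] equals that of [u - v], which Cauchy-Schwarz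
    makes arbitrarily small. *)
Lemma kerP_closed (D : int -> set (set X)) j u : L2 mu u ->
  (forall e : R, 0 < e -> exists2 v, kerP mu D j v &
    (L2norm mu (fun x => (u x - v x)%R) < e%:E)%E) ->
  kerP mu D j u.
Proof.
move=> Lu ucl; apply/kerPP; split=> // w sw; have [Lw _] := sw.
have Nw : L2norm mu w \is a fin_num.
  rewrite ge0_fin_numE; last exact: Lnorm_ge0.
  by move: Lw; rewrite /L2/= inE => /andP[_]; rewrite inE.
have N0 : 0 <= fine (L2norm mu w) by rewrite fine_ge0// Lnorm_ge0.
apply/eqP; rewrite -abse_eq0 eq_le abse_ge0 andbT.
apply/lee_addgt0Pr => e e0; rewrite add0e.
(* The [+ 1] keeps the divisor positive when [w] has norm zero. *)
have N1 : 0 < fine (L2norm mu w) + 1 by rewrite ltr_wpDl.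
have [v /kerPP[Lv v0] uv] := ucl _ (divr_gt0 e0 N1).
have -> : L2inner mu u w = L2inner mu (fun x => u x - v x) w.
  transitivity (L2inner mu (fun x => -1 * v x + u x) w).
    by rewrite L2inner_linear// v0// mule0 add0e.
  by apply: eq_integral => x _; rewrite mulN1r addrC.
apply: le_trans (L2inner_le (L2_sub Lu Lv) Lw) _.
apply: (@le_trans _ _ ((e / (fine (L2norm mu w) + 1))%:E * L2norm mu w)%E).
  by apply: lee_wpmul2r; [exact: Lnorm_ge0|exact: ltW].
rewrite -(fineK Nw) -EFinM lee_fin -mulrA ler_piMr// ?(ltW e0)//.
by rewrite mulrC ler_pdivrMr// mul1r lerDl.
Qed.

End L2Theory.

(** * The energy: linearity of its domain and coercivity *)

Section Energy.
Context {R : realType} {X : pointedMetricType R}.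
Variable mu : {measure set (borel X) -> \bar R}.
Variables gamma sigma : R.
Hypothesis gamma_gt0 : 0 < gamma.
Hypothesis regX : ahlfors_regular mu gamma.
Hypothesis sigma_gt0 : 0 < sigma.
Variable D : int -> set (set X).
Hypothesis dyadicD : dyadic_family D.
Implicit Types u v w : borel X -> R.

Definition energy_density u (z : borel X * borel X) : R :=
  (u z.1 - u z.2) ^+ 2 * energy_kernel mu sigma z.

Lemma energy_density_ge0 u z : 0 <= energy_density u z.
Proof. by rewrite mulr_ge0// ?sqr_ge0// powR_ge0. Qed.

Lemma regular_ball_gt0 (x : X) (r : R) : 0 < r -> (0 < mu (ball x r))%E.
Proof.
have [c1 [c2 [c10 _ h]]] := regX => r0.
by have [/(lt_le_trans _)->//] := h x _ r0; rewrite lte_fin mulr_gt0// powR_gt0.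
Qed.

(** Off the diagonal regularity makes the measure of the ball positive and finite, so the extended
    quotient is a real power; on the diagonal both integrands vanish. *)
Lemma energyE u : (energy mu sigma u =
  \int[mu]_y \int[mu]_x (energy_density u (x, y))%:E)%E.
Proof.
apply: eq_integral => y _; apply: eq_integral => x _.
rewrite /energy_density /energy_kernel/= real_normK ?num_real//.
have [->|xy] := eqVneq x y; first by rewrite subrr expr0n/= mul0e mul0r.
have B0 : (0 < mu (ball (x : X) (mdist (x : X) y)))%E.
  by apply: regular_ball_gt0; rewrite mdist_gt0.
move: B0 (regular_ball_lty regX x (mdist (x : X) y)).
case: (mu _) => [r| |]//; rewrite lte_fin => r0 _.
by rewrite poweR_EFin inver gt_eqF ?powR_gt0// powRN -EFinM.
Qed.

Lemma measurable_energy_density u : measurable_fun setT u ->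
  measurable_fun setT (energy_density u).
Proof.
move=> mfu; apply: measurable_funM; last first.
  exact: (measurable_energy_kernel regX dyadicD).
apply: measurable_funX; apply: measurable_funB.
  exact: (measurableT_comp mfu measurable_fst).
exact: (measurableT_comp mfu measurable_snd).
Qed.

Lemma measurable_energy_densityl u y : measurable_fun setT u ->
  measurable_fun setT (fun x => (energy_density u (x, y))%:E).
Proof.
move=> mfu; apply/measurable_EFinP.
exact: (measurableT_comp (measurable_energy_density mfu) (pair2_measurable y)).
Qed.

Lemma measurable_energy_inner u : measurable_fun setT u ->
  measurable_fun setT (fun y => \int[mu]_x (energy_density u (x, y))%:E)%E.
Proof.
move=> mfu; have [mu' ->] := sigma_finite_measureP (regular_sigma_finite regX).
have md : measurable_fun setT (EFin \o energy_density u).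
  by apply/measurable_EFinP; exact: measurable_energy_density.
have d0 z : (0 <= (EFin \o energy_density u) z)%E.
  by rewrite lee_fin energy_density_ge0.
exact: (@measurable_fun_fubini_tonelli_G _ _ _ _ _ mu' _ md d0).
Qed.

(** The pointwise bound survives multiplication by the nonnegative kernel and both integrations;
    additivity of the inner and outer integrals is where measurability enters. *)
Lemma energy_le_lincomb (a b : R) u v w : 0 <= a -> 0 <= b ->
  measurable_fun setT u -> measurable_fun setT v -> measurable_fun setT w ->
  (forall x y, (w x - w y) ^+ 2 <=
               a * (u x - u y) ^+ 2 + b * (v x - v y) ^+ 2) ->
  (energy mu sigma w <= a%:E * energy mu sigma u + b%:E * energy mu sigma v)%E.
Proof.
move=> a0 b0 mfu mfv mfw wuv; rewrite !energyE.
have i0 f y : (0 <= \int[mu]_x (energy_density f (x, y))%:E)%E.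
  by apply: integral_ge0 => x _; rewrite lee_fin energy_density_ge0.
have mi := measurable_energy_inner.
rewrite -!ge0_integralZl//; [|exact: mi|exact: mi].
rewrite -ge0_integralD//; last first.
- by apply: measurable_funeM; exact: mi.
- by move=> y _; rewrite mule_ge0.
- by apply: measurable_funeM; exact: mi.
- by move=> y _; rewrite mule_ge0.
apply: ge0_le_integral => //; [exact: mi| |].
  by apply: emeasurable_funD; apply: measurable_funeM; exact: mi.
move=> y _; have me := measurable_energy_densityl y.
have d0 f x : (0 <= (energy_density f (x, y))%:E)%E.
  by rewrite lee_fin energy_density_ge0.
rewrite -!ge0_integralZl//; [|exact: me|exact: me].
rewrite -ge0_integralD//; last first.
- by apply: measurable_funeM; exact: me.
- by move=> x _; rewrite mule_ge0.
- by apply: measurable_funeM; exact: me.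
- by move=> x _; rewrite mule_ge0.
apply: ge0_le_integral => //; [exact: me| |].
  by apply: emeasurable_funD; apply: measurable_funeM; exact: me.
move=> x _; rewrite -!EFinM -EFinD lee_fin /energy_density/=.
by rewrite 2!(mulrA _ (_ ^+ 2)) -mulrDl ler_wpM2r ?powR_ge0.
Qed.

Lemma Hspace_linear_subspace : linear_subspace (Hspace mu sigma).
Proof.
split.
  split; first exact: L2_cst0.
  rewrite energyE integral0_eq// => y _; apply: integral0_eq => x _.
  by rewrite /energy_density subrr expr0n mul0r.
move=> a u v [Lu Eu] [Lv Ev]; split; first exact: L2_linear.
have mfu := L2_measurable Lu; have mfv := L2_measurable Lv.
(* With [s] and [t] the increments of [u] and [v], [(a s + t)^2 <= 2 a^2 s^2 + 2 t^2], the
   difference being [(a s - t)^2]. *)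
apply: (@le_lt_trans _ _
  ((2 * a ^+ 2)%:E * energy mu sigma u + 2%:E * energy mu sigma v)%E).
  apply: energy_le_lincomb => //.
  - by rewrite mulr_ge0// sqr_ge0.
  - exact: L2_measurable (L2_linear a Lu Lv).
  - move=> x y; rewrite -subr_ge0 (_ : _ - _ =
      (a * (u x - u y) - (v x - v y)) ^+ 2) ?sqr_ge0//; ring.
have Zlty (r : R) f : 0 <= r -> (energy mu sigma f < +oo)%E ->
    (r%:E * energy mu sigma f < +oo)%E.
  by rewrite -lee_fin => r0; exact: lte_mul_pinfty.
have a0 : 0 <= 2 * a ^+ 2 by rewrite mulr_ge0// sqr_ge0.
exact: lte_add_pinfty (Zlty _ _ a0 Eu) (Zlty _ _ (ler0n _ 2) Ev).
Qed.

Lemma energy_kernel_ge j : exists2 k : R, 0 < k & forall Q x y,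
  D j Q -> Q x -> Q y -> x != y -> k <= energy_kernel mu sigma (x, y).
Proof.
have [nu [a [/andP[nu0 _] a0 h]]] := dyadic_mdist dyadicD.
have [c1 [c2 [c10 c20 reg]]] := regX.
have d0 : 0 < a * nu ^ j by rewrite mulr_gt0// exprz_gt0.
have c0 : 0 < c2 * (a * nu ^ j) `^ gamma by rewrite mulr_gt0// powR_gt0.
exists ((c2 * (a * nu ^ j) `^ gamma) `^ (- (1 + 2 * sigma))).
  by rewrite powR_gt0.
move=> Q x y DQ Qx Qy xy; rewrite /energy_kernel/=.
have xy0 : 0 < mdist x y by rewrite mdist_gt0.
have [_] := reg x _ xy0; have := regular_ball_gt0 x xy0.
have := regular_ball_lty regX x (mdist x y).
case: (mu _) => [r| |]//= _; rewrite lte_fin lee_fin => r0 rle.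
rewrite !powRN lef_pV2 ?posrE ?powR_gt0//.
apply: ge0_ler_powR; rewrite ?nnegrE ?(ltW r0) ?(ltW c0)//.
  by rewrite addr_ge0// mulr_ge0// ltW.
apply: (le_trans rle); rewrite ler_pM2l//.
apply: ge0_ler_powR; rewrite ?nnegrE ?(ltW gamma_gt0) ?(ltW xy0) ?(ltW d0)//.
exact: h DQ Qx Qy.
Qed.

(* Since [u] has mean zero on [Q], expanding the square [(u x - u y)^2] and
   integrating over [x] in [Q] leaves at least [mu Q * u y ^ 2]. *)
Lemma energy_inner_ge j : exists2 c : R, 0 < c & forall u, kerP mu D j u ->
  forall y, ((c * u y ^+ 2)%:E <= \int[mu]_x (energy_density u (x, y))%:E)%E.
Proof.
have [k k0 kP] := energy_kernel_ge j.
have [m m0 mP] := dyadic_measure_ge regX dyadicD j.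
exists (k * m); first by rewrite mulr_gt0.
move=> u /kerPP[Lu u0] y.
have [Q DQ Qy] := dyadic_cover dyadicD j y.
have mQ : measurable (Q : set (borel X)).
  exact: (dyadic_measurable dyadicD DQ).
have LQ : L2 mu \1_Q.
  by apply: L2_indic => //; exact: (dyadic_measure_lty regX dyadicD DQ).
(* A cube of level [j] that meets [Q] equals [Q], so [\1_Q] is a legitimate test function;
   orthogonality to it says that [u] has mean zero on [Q]. *)
have sQ : stepL2 mu D j \1_Q.
  split=> // P DP x z Px Pz; rewrite !indicE.
  have [_ tD _] := dyadic_partition dyadicD j.
  suff PQ t t' : P t -> P t' -> t \in Q -> t' \in Q.
    by congr (_%:R); congr nat_of_bool; apply/idP/idP; exact: PQ.
  move=> Pt Pt' /set_mem Qt; apply/mem_set.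
  by rewrite -(tD _ _ DP DQ)//; exists t.
have uQ := u0 _ sQ.
set I := (\int[mu]_x _)%E.
(* Once the infinite case is set aside, the density is integrable and can be compared with a
   function of variable sign. *)
have [->|Ioo] := eqVneq I +oo%E; first exact: leey.
have intd : mu.-integrable setT (fun x => (energy_density u (x, y))%:E).
  apply/integrableP; split.
    exact: (measurable_energy_densityl y (L2_measurable Lu)).
  under eq_integral do rewrite gee0_abs ?lee_fin ?energy_density_ge0//.
  by rewrite ltey.
have intu := L2_mul_integrable Lu LQ.
have intQ : mu.-integrable setT (fun x => (\1_Q x)%:E).
  apply: eq_integrable (L2_mul_integrable LQ LQ) => // x _.
  by rewrite indicE; case: (_ \in _); rewrite ?mulr1 ?mulr0.
(* [A + B * u x] is [k * (u x - u y) ^+ 2] without its term [k * u x ^+ 2]. Over [Q] the [B] part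
   integrates to zero and the [A] part to [A * mu Q >= A * m]. *)
pose A := k * u y ^+ 2; pose B := - (2 * k * u y).
apply: (@le_trans _ _
    (\int[mu]_x (A%:E * (\1_Q x)%:E + B%:E * (u x * \1_Q x)%:E))%E).
  rewrite integralD//; [|exact: integrableZl|exact: integrableZl].
  rewrite !integralZl// -/(L2inner mu u \1_Q) uQ mule0 adde0.
  rewrite integral_indic// setIT (@le_trans _ _ (A%:E * m%:E)%E)//.
    by rewrite -EFinM lee_fin /A mulrAC.
  by apply: lee_wpmul2l; [rewrite lee_fin mulr_ge0 ?sqr_ge0// ltW|exact: mP].
apply: le_integral => //.
  by apply: integrableD => //; exact: integrableZl.
move=> x _; rewrite -!EFinM -EFinD lee_fin indicE.
have [/set_mem Qx|_] := boolP (x \in Q); last first.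
  by rewrite !mulr0 addr0 energy_density_ge0.
rewrite !mulr1 (@le_trans _ _ (k * (u x - u y) ^+ 2))//.
  rewrite -subr_ge0 (_ : _ - _ = k * u x ^+ 2).
    by rewrite mulr_ge0 ?sqr_ge0// ltW.
  by rewrite /A /B; ring.
rewrite /energy_density/=.
(* The kernel bound fails on the diagonal, but there both sides are [0]. *)
have [->|xy] := eqVneq x y; first by rewrite subrr expr0n mulr0 mul0r.
by rewrite mulrC ler_wpM2l ?sqr_ge0//; exact: kP DQ Qx Qy xy.
Qed.

Lemma energy_coercive j : exists2 c : R, 0 < c & forall u, kerP mu D j u ->
  (c%:E * L2norm mu u ^+ 2 <= energy mu sigma u)%E.
Proof.
have [c c0 cP] := energy_inner_ge j; exists c => // u ku.
have mfu : measurable_fun setT u.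
  by have [Lu _] := ku; exact: (L2_measurable Lu).
have mfu2 : measurable_fun setT (fun x => (u x ^+ 2)%:E).
  by apply/measurable_EFinP; exact: measurable_funX.
rewrite L2normX2 energyE -ge0_integralZl ?lee_fin ?(ltW c0)//; last first.
  by move=> x _; rewrite lee_fin sqr_ge0.
apply: ge0_le_integral => //.
- by move=> y _; rewrite -EFinM lee_fin mulr_ge0 ?sqr_ge0// ltW.
- by apply: measurable_funeM.
- exact: measurable_energy_inner.
- by move=> y _; rewrite -EFinM; exact: cP.
Qed.

End Energy.

Theorem corollary5 (R : realType) (X : pointedMetricType R)
    (mu : {measure set (borel X) -> \bar R}) (gamma sigma : R)
    (D : int -> set (set X)) (gamma_gt0 : 0 < gamma)
    (regX : ahlfors_regular mu gamma) (dyadicD : dyadic_family D)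
    (sigma_gt0 : 0 < sigma) :
  forall j : int,
    space_of_coercivity mu sigma (Hspace mu sigma `&` kerP mu D j) /\
    exists2 C : R, 0 < C &
      forall u : borel X -> R, Hspace mu sigma u -> kerP mu D j u ->
        (C%:E * L2norm mu u ^+ 2 <= energy mu sigma u)%E.
Proof.
move=> j; have [c c0 cP] := energy_coercive gamma_gt0 regX sigma_gt0 dyadicD j.
split; last by exists c => // u _; exact: cP.
split=> [u []//| | |]; last by exists c => // u [_]; exact: cP.
  have [H0 Hl] := Hspace_linear_subspace sigma regX dyadicD.
  have [K0 Kl] := kerP_linear_subspace mu D j.
  split; first exact: (conj H0 K0).
  move=> a u v [Hu Ku] [Hv Kv].
  exact: (conj (Hl a u v Hu Hv) (Kl a u v Ku Kv)).
(* [Hnorm] dominates [L2norm], so closedness of [kerP] in [L2] suffices. *)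
move=> u Hu ucl; split=> //; apply: kerP_closed; first by case: Hu.
move=> e e0; have [v [_ Kv] uv] := ucl _ e0; exists v => //.
by apply: le_lt_trans uv; rewrite /Hnorm leeDl// sqrte_ge0.
Qed.
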